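(* Consider a functional pure type system specification $(\mathcal S,\mathcal A,\mathcal R)$, its explicitly-typed pure type system (EPTS) and its Dedukti encoding $(\Sigma_{EPTS},\mathscr R_{EPTS})$ with translation $[\![-]\!]$. Let $\Gamma$ be an EPTS context and $M,A$ EPTS terms. (1) If $\Gamma$ is well-formed then $[\![\Gamma]\!]$ is well-formed in Dedukti (in signature $\Sigma_{EPTS}$). (2) If $\Gamma\vdash M:A$, then: if $A$ is a top-sort, $[\![\Gamma]\!]\vdash_{DK}[\![M]\!]:\mathbf U_A$; otherwise $[\![\Gamma]\!]\vdash_{DK}[\![M]\!]:\mathbf{El}_{s_A}\,[\![A]\!]$, where $s_A$ is the sort with $\Gamma\vdash A:s_A$.
   Context: A functional PTS specification consists of a set of sorts $\mathcal S$, $\mathcal A\subseteq\mathcal S^2$ and $\mathcal R\subseteq\mathcal S^3$, with $\mathcal A$ functional and $\mathcal R$ functional in its first two components. A sort $s$ is a top-sort if there is no $s'$ with $(s,s')\in\mathcal A$. EPTS terms: $M::=x\mid s\mid\Pi_{s_1,s_2}(A,x.B)\mid\lambda_{s_1,s_2}(A,x.B,x.M)\mid @_{s_1,s_2}(A,x.B,M,N)$ ($x$ bound in $B$ and in the body $M$). EPTS reduction is the context closure of $@_{s_1,s_2}(A,x.B,\lambda_{s_1,s_2}(A',x.B',x.M),N)\hookrightarrow M\{N/x\}$ for $(s_1,s_2,s_3)\in\mathcal R$, and $\equiv$ the generated equivalence. EPTS typing: $-$ is well-formed; if $\Gamma\vdash A:s$ and $x\notin\Gamma$ then $\Gamma,x:A$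 is well-formed; (Conv) $\Gamma\vdash M:A$, $\Gamma\vdash B:s$, $A\equiv B$ give $\Gamma\vdash M:B$; (Sort) $\Gamma$ well-formed and $(s_1,s_2)\in\mathcal A$ give $\Gamma\vdash s_1:s_2$; (Var) $\Gamma$ well-formed and $x:A\in\Gamma$ give $\Gamma\vdash x:A$; for $(s_1,s_2,s_3)\in\mathcal R$: (Prod) $\Gamma\vdash A:s_1$, $\Gamma,x:A\vdash B:s_2$ give $\Gamma\vdash\Pi_{s_1,s_2}(A,x.B):s_3$; (Abs) additionally $\Gamma,x:A\vdash M:B$ gives $\Gamma\vdash\lambda_{s_1,s_2}(A,x.B,x.M):\Pi_{s_1,s_2}(A,x.B)$; (App) $\Gamma\vdash A:s_1$, $\Gamma,x:A\vdash B:s_2$, $\Gamma\vdash N:A$, $\Gamma\vdash M:\Pi_{s_1,s_2}(A,x.B)$ give $\Gamma\vdash @_{s_1,s_2}(A,x.B,M,N):B\{N/x\}$. Since the system is functional, the sort of a type in a context is unique. Dedukti: terms $x\mid c[\vec M]\mid\mathtt{TYPE}\mid\mathtt{KIND}\mid MN\mid\lambda x:A.M\mid\Pi x:A.B$ with constants of fixed arity (written $c\,\vec M$); typing is the $\lambda\Pi$-calculus with constants declared $c[\Delta]:A$ in a signature and typed by $\Sigma;\Gamma\vdash c[\vec M]:A\{\vec M\}$ when $\vec M$ instantiates $\Delta$, with conversion modulo $\beta$ and the rewrite rules. The theory $(\Sigma_{EPTS},\mathscr R_{EPTS})$: for $s\in\mathcal S$, $\mathbf U_s:\mathtt{TYPE}$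 and $\mathbf{El}_s[A:\mathbf U_s]:\mathtt{TYPE}$; for $(s_1,s_2)\in\mathcal A$, $\mathbf u_{s_1}:\mathbf U_{s_2}$ and the rule $\mathbf{El}_{s_2}\,\mathbf u_{s_1}\hookrightarrow\mathbf U_{s_1}$; for $(s_1,s_2,s_3)\in\mathcal R$: $\mathbf{Prod}_{s_1,s_2}[A:\mathbf U_{s_1};B:\mathbf{El}_{s_1}A\to\mathbf U_{s_2}]:\mathbf U_{s_3}$, $\mathbf{abs}_{s_1,s_2}[A:\mathbf U_{s_1};B:\mathbf{El}_{s_1}A\to\mathbf U_{s_2};M:\Pi x:\mathbf{El}_{s_1}A.\mathbf{El}_{s_2}(B\,x)]:\mathbf{El}_{s_3}(\mathbf{Prod}_{s_1,s_2}A\,B)$, $\mathbf{app}_{s_1,s_2}[A:\mathbf U_{s_1};B:\mathbf{El}_{s_1}A\to\mathbf U_{s_2};M:\mathbf{El}_{s_3}(\mathbf{Prod}_{s_1,s_2}A\,B);N:\mathbf{El}_{s_1}A]:\mathbf{El}_{s_2}(B\,N)$, and the rule $\mathbf{app}_{s_1,s_2}\,A\,B\,(\mathbf{abs}_{s_1,s_2}\,A'\,B'\,M)\,N\hookrightarrow M\,N$. $\Gamma\vdash_{DK}M:A$ means $\Sigma_{EPTS};\Gamma\vdash M:A$ in this theory. Translation: $[\![x]\!]=x$, $[\![s]\!]=\mathbf u_s$, $[\![\Pi_{s_1,s_2}(A,x.B)]\!]=\mathbf{Prod}_{s_1,s_2}[\![A]\!](\lambda x:\mathbf{El}_{s_1}[\![A]\!].[\![B]\!])$,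 $[\![\lambda_{s_1,s_2}(A,x.B,x.M)]\!]=\mathbf{abs}_{s_1,s_2}[\![A]\!](\lambda x:\mathbf{El}_{s_1}[\![A]\!].[\![B]\!])(\lambda x:\mathbf{El}_{s_1}[\![A]\!].[\![M]\!])$, $[\![@_{s_1,s_2}(A,x.B,M,N)]\!]=\mathbf{app}_{s_1,s_2}[\![A]\!](\lambda x:\mathbf{El}_{s_1}[\![A]\!].[\![B]\!])[\![M]\!][\![N]\!]$; on well-formed contexts $[\![-]\!]=-$ and $[\![\Gamma,x:A]\!]=[\![\Gamma]\!],x:\mathbf{El}_{s_A}[\![A]\!]$ where $\Gamma\vdash A:s_A$. *)

(* Defs.v *)
(* Both calculi are represented with de Bruijn indices; in every
   context (a list of types) the most recently declared variable comes first,
   so that the freshness conditions on variables disappear. *)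
From Stdlib Require Import List Relations.
From Stdlib Require Vector Fin.
Import Vector.VectorNotations.

Record pts_spec : Type := PTSSpec {
  sort : Type;
  axm : sort -> sort -> Prop;
  rul : sort -> sort -> sort -> Prop
}.

Definition functional_pts (P : pts_spec) : Prop :=
  (forall s s1 s2, axm P s s1 -> axm P s s2 -> s1 = s2) /\
  (forall s1 s2 s3 s4, rul P s1 s2 s3 -> rul P s1 s2 s4 -> s3 = s4).

Definition top_sort (P : pts_spec) (s : sort P) : Prop :=
  ~ exists s', axm P s s'.

(* [ePi s1 s2 A B], [eLam s1 s2 A B M] and [eApp s1 s2 A B M N] stand for
   Pi_{s1,s2}(A, x.B), lambda_{s1,s2}(A, x.B, x.M) and @_{s1,s2}(A, x.B, M, N):
   one variable is bound in each [B] and in the body [M] of [eLam]. *)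
Inductive eterm (S : Type) : Type :=
| eVar (n : nat)
| eSort (s : S)
| ePi (s1 s2 : S) (A B : eterm S)
| eLam (s1 s2 : S) (A B M : eterm S)
| eApp (s1 s2 : S) (A B M N : eterm S).

Arguments eVar {S} n.
Arguments eSort {S} s.
Arguments ePi {S} s1 s2 A B.
Arguments eLam {S} s1 s2 A B M.
Arguments eApp {S} s1 s2 A B M N.

Definition upren (r : nat -> nat) (n : nat) : nat :=
  match n with 0 => 0 | S m => S (r m) end.

Fixpoint eren {S : Type} (r : nat -> nat) (M : eterm S) : eterm S :=
  match M with
  | eVar n => eVar (r n)
  | eSort s => eSort s
  | ePi s1 s2 A B => ePi s1 s2 (eren r A) (eren (upren r) B)
  | eLam s1 s2 A B M =>
      eLam s1 s2 (eren r A) (eren (upren r) B) (eren (upren r) M)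
  | eApp s1 s2 A B M N =>
      eApp s1 s2 (eren r A) (eren (upren r) B) (eren r M) (eren r N)
  end.

Definition eup {S : Type} (f : nat -> eterm S) (n : nat) : eterm S :=
  match n with 0 => eVar 0 | Datatypes.S m => eren Datatypes.S (f m) end.

Fixpoint esubst {S : Type} (f : nat -> eterm S) (M : eterm S) : eterm S :=
  match M with
  | eVar n => f n
  | eSort s => eSort s
  | ePi s1 s2 A B => ePi s1 s2 (esubst f A) (esubst (eup f) B)
  | eLam s1 s2 A B M =>
      eLam s1 s2 (esubst f A) (esubst (eup f) B) (esubst (eup f) M)
  | eApp s1 s2 A B M N =>
      eApp s1 s2 (esubst f A) (esubst (eup f) B) (esubst f M) (esubst f N)
  end.

(* M{N/x}, where x is the variable 0 of M. *)
Definition esubst1 {S : Type} (N M : eterm S) : eterm S :=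
  esubst (fun n => match n with 0 => N | Datatypes.S m => eVar m end) M.

Inductive ered (P : pts_spec) : eterm (sort P) -> eterm (sort P) -> Prop :=
| ered_beta s1 s2 s3 A B A' B' M N :
    rul P s1 s2 s3 ->
    ered P (eApp s1 s2 A B (eLam s1 s2 A' B' M) N) (esubst1 N M)
| ered_pi1 s1 s2 A A' B :
    ered P A A' -> ered P (ePi s1 s2 A B) (ePi s1 s2 A' B)
| ered_pi2 s1 s2 A B B' :
    ered P B B' -> ered P (ePi s1 s2 A B) (ePi s1 s2 A B')
| ered_lam1 s1 s2 A A' B M :
    ered P A A' -> ered P (eLam s1 s2 A B M) (eLam s1 s2 A' B M)
| ered_lam2 s1 s2 A B B' M :
    ered P B B' -> ered P (eLam s1 s2 A B M) (eLam s1 s2 A B' M)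
| ered_lam3 s1 s2 A B M M' :
    ered P M M' -> ered P (eLam s1 s2 A B M) (eLam s1 s2 A B M')
| ered_app1 s1 s2 A A' B M N :
    ered P A A' -> ered P (eApp s1 s2 A B M N) (eApp s1 s2 A' B M N)
| ered_app2 s1 s2 A B B' M N :
    ered P B B' -> ered P (eApp s1 s2 A B M N) (eApp s1 s2 A B' M N)
| ered_app3 s1 s2 A B M M' N :
    ered P M M' -> ered P (eApp s1 s2 A B M N) (eApp s1 s2 A B M' N)
| ered_app4 s1 s2 A B M N N' :
    ered P N N' -> ered P (eApp s1 s2 A B M N) (eApp s1 s2 A B M N').

Definition econv (P : pts_spec) : eterm (sort P) -> eterm (sort P) -> Prop :=
  clos_refl_sym_trans _ (ered P).

Definition ectx (P : pts_spec) : Type := list (eterm (sort P)).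

Inductive ewf (P : pts_spec) : ectx P -> Prop :=
| ewf_nil : ewf P nil
| ewf_cons G A s :
    ety P G A (eSort s) -> ewf P (cons A G)
with ety (P : pts_spec) : ectx P -> eterm (sort P) -> eterm (sort P) -> Prop :=
| ety_conv G M A B s :
    ety P G M A -> ety P G B (eSort s) -> econv P A B -> ety P G M B
| ety_sort G s1 s2 :
    ewf P G -> axm P s1 s2 -> ety P G (eSort s1) (eSort s2)
| ety_var G n A :
    ewf P G -> nth_error G n = Some A ->
    ety P G (eVar n) (eren (fun m => m + S n) A)
| ety_pi G s1 s2 s3 A B :
    rul P s1 s2 s3 ->
    ety P G A (eSort s1) -> ety P (cons A G) B (eSort s2) ->
    ety P G (ePi s1 s2 A B) (eSort s3)
| ety_lam G s1 s2 s3 A B M :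
    rul P s1 s2 s3 ->
    ety P G A (eSort s1) -> ety P (cons A G) B (eSort s2) ->
    ety P (cons A G) M B ->
    ety P G (eLam s1 s2 A B M) (ePi s1 s2 A B)
| ety_app G s1 s2 s3 A B M N :
    rul P s1 s2 s3 ->
    ety P G A (eSort s1) -> ety P (cons A G) B (eSort s2) ->
    ety P G N A -> ety P G M (ePi s1 s2 A B) ->
    ety P G (eApp s1 s2 A B M N) (esubst1 N B).

Inductive dsort : Type := TYPE | KIND.

(* Constants have a fixed arity and are fully applied: [dCst c v] is c[v]. *)
Inductive dterm {C : Type} (ar : C -> nat) : Type :=
| dVar (n : nat)
| dCst (c : C) (v : Vector.t (dterm ar) (ar c))
| dSort (s : dsort)
| dApp (M N : dterm ar)
| dLam (A M : dterm ar)
| dPi (A B : dterm ar).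

Arguments dVar {C ar} n.
Arguments dCst {C ar} c v.
Arguments dSort {C ar} s.
Arguments dApp {C ar} M N.
Arguments dLam {C ar} A M.
Arguments dPi {C ar} A B.

Fixpoint dren {C : Type} {ar : C -> nat} (r : nat -> nat) (M : dterm ar)
  : dterm ar :=
  match M with
  | dVar n => dVar (r n)
  | dCst c v => dCst c (Vector.map (dren r) v)
  | dSort s => dSort s
  | dApp M N => dApp (dren r M) (dren r N)
  | dLam A M => dLam (dren r A) (dren (upren r) M)
  | dPi A B => dPi (dren r A) (dren (upren r) B)
  end.

Definition dup {C : Type} {ar : C -> nat} (f : nat -> dterm ar) (n : nat)
  : dterm ar :=
  match n with 0 => dVar 0 | S m => dren S (f m) end.

Fixpoint dsubst {C : Type} {ar : C -> nat} (f : nat -> dterm ar) (M : dterm ar)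
  : dterm ar :=
  match M with
  | dVar n => f n
  | dCst c v => dCst c (Vector.map (dsubst f) v)
  | dSort s => dSort s
  | dApp M N => dApp (dsubst f M) (dsubst f N)
  | dLam A M => dLam (dsubst f A) (dsubst (dup f) M)
  | dPi A B => dPi (dsubst f A) (dsubst (dup f) B)
  end.

(* M{l}: simultaneous substitution of the variables 0, ..., length l - 1 of M
   by the elements of l. *)
Definition dsubstl {C : Type} {ar : C -> nat} (l : list (dterm ar))
  (M : dterm ar) : dterm ar :=
  dsubst (fun n => match nth_error l n with
                   | Some N => N
                   | None => dVar (n - length l)
                   end) M.

Definition dsubst1 {C : Type} {ar : C -> nat} (N M : dterm ar) : dterm ar :=
  dsubstl (cons N nil) M.

(* [dsig T c D A] means that the declaration c[D] : A is in the signature.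
   [drule T l r] means that l --> r is a rewrite rule, whose pattern variables
   are the free variables of l. *)
Record dtheory {C : Type} (ar : C -> nat) : Type := DTheory {
  dsig : C -> list (dterm ar) -> dterm ar -> Prop;
  drule : dterm ar -> dterm ar -> Prop
}.

Arguments dsig {C ar} d _ _ _.
Arguments drule {C ar} d _ _.
Arguments DTheory {C ar} dsig drule.

Inductive dred {C : Type} {ar : C -> nat} (T : dtheory ar)
  : dterm ar -> dterm ar -> Prop :=
| dred_beta A M N : dred T (dApp (dLam A M) N) (dsubst1 N M)
| dred_rule l r f : drule T l r -> dred T (dsubst f l) (dsubst f r)
| dred_cst c (v : Vector.t (dterm ar) (ar c)) (i : Fin.t (ar c)) M :
    dred T (Vector.nth v i) M -> dred T (dCst c v) (dCst c (Vector.replace v i M))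
| dred_app1 M M' N : dred T M M' -> dred T (dApp M N) (dApp M' N)
| dred_app2 M N N' : dred T N N' -> dred T (dApp M N) (dApp M N')
| dred_lam1 A A' M : dred T A A' -> dred T (dLam A M) (dLam A' M)
| dred_lam2 A M M' : dred T M M' -> dred T (dLam A M) (dLam A M')
| dred_pi1 A A' B : dred T A A' -> dred T (dPi A B) (dPi A' B)
| dred_pi2 A B B' : dred T B B' -> dred T (dPi A B) (dPi A B').

Definition dconv {C : Type} {ar : C -> nat} (T : dtheory ar)
  : dterm ar -> dterm ar -> Prop :=
  clos_refl_sym_trans _ (dred T).

(* [dinst T G l D] is the judgement G |- l : D that l instantiates D; like the
   context D, the list l has its last component first, hence the [rev] in
   [dty_cst].  The premise D |- A : s of [dty_cst] is what makes a constant
   usable only when its declaration is itself well-typed in the signature. *)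
Inductive dwf {C : Type} {ar : C -> nat} (T : dtheory ar)
  : list (dterm ar) -> Prop :=
| dwf_nil : dwf T nil
| dwf_cons G A :
    dty T G A (dSort TYPE) -> dwf T (cons A G)
with dty {C : Type} {ar : C -> nat} (T : dtheory ar)
  : list (dterm ar) -> dterm ar -> dterm ar -> Prop :=
| dty_conv G M A B s :
    dty T G M A -> dty T G B (dSort s) -> dconv T A B -> dty T G M B
| dty_sort G :
    dwf T G -> dty T G (dSort TYPE) (dSort KIND)
| dty_var G n A :
    dwf T G -> nth_error G n = Some A ->
    dty T G (dVar n) (dren (fun m => m + S n) A)
| dty_cst G c (v : Vector.t (dterm ar) (ar c)) D A s :
    dsig T c D A -> dty T D A (dSort s) ->
    dinst T G (rev (Vector.to_list v)) D ->
    dty T G (dCst c v) (dsubstl (rev (Vector.to_list v)) A)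
| dty_pi G A B s :
    dty T G A (dSort TYPE) -> dty T (cons A G) B (dSort s) ->
    dty T G (dPi A B) (dSort s)
| dty_lam G A B M s :
    dty T G A (dSort TYPE) -> dty T (cons A G) B (dSort s) ->
    dty T (cons A G) M B ->
    dty T G (dLam A M) (dPi A B)
| dty_app G A B M N :
    dty T G M (dPi A B) -> dty T G N A ->
    dty T G (dApp M N) (dsubst1 N B)
with dinst {C : Type} {ar : C -> nat} (T : dtheory ar)
  : list (dterm ar) -> list (dterm ar) -> list (dterm ar) -> Prop :=
| dinst_nil G :
    dwf T G -> dinst T G nil nil
| dinst_cons G l D N A :
    dinst T G l D -> dty T G N (dsubstl l A) ->
    dinst T G (cons N l) (cons A D).

(* The names of the constants.  Only those declared by [epts_sig] are in the
   signature; e.g. the name u_s exists for a top-sort s, because the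
   translation is defined on all raw terms, but it is not declared. *)
Inductive epts_cst (S : Type) : Type :=
| cU (s : S)
| cEl (s : S)
| cu (s : S)
| cProd (s1 s2 : S)
| cabs (s1 s2 : S)
| capp (s1 s2 : S).

Arguments cU {S} s.
Arguments cEl {S} s.
Arguments cu {S} s.
Arguments cProd {S} s1 s2.
Arguments cabs {S} s1 s2.
Arguments capp {S} s1 s2.

Definition epts_ar {S : Type} (c : epts_cst S) : nat :=
  match c with
  | cU _ => 0
  | cEl _ => 1
  | cu _ => 0
  | cProd _ _ => 2
  | cabs _ _ => 3
  | capp _ _ => 4
  end.

Definition dkterm (S : Type) : Type := dterm (@epts_ar S).

Definition dU {S : Type} (s : S) : dkterm S := dCst (cU s) []%vector.
Definition dEl {S : Type} (s : S) (A : dkterm S) : dkterm S :=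
  dCst (cEl s) [A]%vector.
Definition du {S : Type} (s : S) : dkterm S := dCst (cu s) []%vector.
Definition dProd {S : Type} (s1 s2 : S) (A B : dkterm S) : dkterm S :=
  dCst (cProd s1 s2) [A; B]%vector.
Definition dabs {S : Type} (s1 s2 : S) (A B M : dkterm S) : dkterm S :=
  dCst (cabs s1 s2) [A; B; M]%vector.
Definition dapp {S : Type} (s1 s2 : S) (A B M N : dkterm S) : dkterm S :=
  dCst (capp s1 s2) [A; B; M; N]%vector.

(* The parameter contexts below are written from right to left:
   A, then B, then M, then N. *)
Inductive epts_sig (P : pts_spec)
  : epts_cst (sort P) -> list (dkterm (sort P)) -> dkterm (sort P) -> Prop :=
| sig_U s : epts_sig P (cU s) nil (dSort TYPE)
| sig_El s : epts_sig P (cEl s) (dU s :: nil)%list (dSort TYPE)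
| sig_u s1 s2 : axm P s1 s2 -> epts_sig P (cu s1) nil (dU s2)
| sig_Prod s1 s2 s3 :
    rul P s1 s2 s3 ->
    epts_sig P (cProd s1 s2)
      (dPi (dEl s1 (dVar 0)) (dU s2) :: dU s1 :: nil)%list
      (dU s3)
| sig_abs s1 s2 s3 :
    rul P s1 s2 s3 ->
    epts_sig P (cabs s1 s2)
      (dPi (dEl s1 (dVar 1)) (dEl s2 (dApp (dVar 1) (dVar 0)))
       :: dPi (dEl s1 (dVar 0)) (dU s2) :: dU s1 :: nil)%list
      (dEl s3 (dProd s1 s2 (dVar 2) (dVar 1)))
| sig_app s1 s2 s3 :
    rul P s1 s2 s3 ->
    epts_sig P (capp s1 s2)
      (dEl s1 (dVar 2)
       :: dEl s3 (dProd s1 s2 (dVar 1) (dVar 0))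
       :: dPi (dEl s1 (dVar 0)) (dU s2) :: dU s1 :: nil)%list
      (dEl s2 (dApp (dVar 2) (dVar 0))).

(* Pattern variables of the second rule: A, B, A', B', M, N are 0, ..., 5. *)
Inductive epts_rule (P : pts_spec)
  : dkterm (sort P) -> dkterm (sort P) -> Prop :=
| rule_El s1 s2 :
    axm P s1 s2 -> epts_rule P (dEl s2 (du s1)) (dU s1)
| rule_app s1 s2 s3 :
    rul P s1 s2 s3 ->
    epts_rule P
      (dapp s1 s2 (dVar 0) (dVar 1)
         (dabs s1 s2 (dVar 2) (dVar 3) (dVar 4)) (dVar 5))
      (dApp (dVar 4) (dVar 5)).

Definition epts_theory (P : pts_spec) : dtheory (@epts_ar (sort P)) :=
  DTheory (epts_sig P) (epts_rule P).

Fixpoint tr {S : Type} (M : eterm S) : dkterm S :=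
  match M with
  | eVar n => dVar n
  | eSort s => du s
  | ePi s1 s2 A B =>
      dProd s1 s2 (tr A) (dLam (dEl s1 (tr A)) (tr B))
  | eLam s1 s2 A B M =>
      dabs s1 s2 (tr A) (dLam (dEl s1 (tr A)) (tr B))
        (dLam (dEl s1 (tr A)) (tr M))
  | eApp s1 s2 A B M N =>
      dapp s1 s2 (tr A) (dLam (dEl s1 (tr A)) (tr B)) (tr M) (tr N)
  end.

(* [tr_ctx P G D] means that D is the translation of G.  It is a relation since
   the sort s_A used at each step is only given by G |- A : s_A. *)
Inductive tr_ctx (P : pts_spec) : ectx P -> list (dkterm (sort P)) -> Prop :=
| tr_nil : tr_ctx P nil nil
| tr_cons G D A s :
    tr_ctx P G D -> ety P G A (eSort s) ->
    tr_ctx P (cons A G) (cons (dEl s (tr A)) D).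

(* Main.v *)
From Stdlib Require Import List Relations Lia Classical.
From Stdlib Require Vector Fin Relations_2 Relations_3 Relations_3_facts.
Require Import Defs.
Import Vector.VectorNotations.

Local Open Scope list_scope.

(* EPTS reduction is confluent on raw terms, whence uniqueness of types, subject
   reduction, and the fact that convertible types live in the same sort. The
   translation commutes with substitution and maps convertible terms to
   convertible terms, and typing is preserved by induction on derivations. The
   delicate case is conversion from A to B : s, where A may be a sort: then B
   reduces to A, so A : s and A is not a top-sort. The types El (B x) in abs and
   El (B N) in app are beta-expansions of the translated types: typing the
   former needs weakening in Dedukti, and typing the reduct of the latter needs
   substitution. *)

(** * Substitution algebras *)

(* The variable [n] of a context is typed by its [n]-th entry moved under the
   [n + 1] most recent declarations. *)
Local Notation shift n := (fun m => m + S n).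

(* [subst_id] and [subst_comp] are stated up to pointwise equality of
   substitutions, which avoids functional extensionality. *)
Record subst_laws {T : Type} (var : nat -> T) (ren : (nat -> nat) -> T -> T)
    (subst : (nat -> T) -> T -> T) (up : (nat -> T) -> nat -> T)
    (subst1 : T -> T -> T) : Prop := {
  up_0 f : up f 0 = var 0;
  up_S f n : up f (S n) = ren S (f n);
  subst_var f n : subst f (var n) = f n;
  subst_id f M : (forall n, f n = var n) -> subst f M = M;
  subst_comp f g h M :
    (forall n, subst g (f n) = h n) -> subst g (subst f M) = subst h M;
  ren_eq_subst r M : ren r M = subst (fun n => var (r n)) M;
  subst1_eq_subst N M :
    subst1 N M = subst (fun n => match n with 0 => N | S m => var m end) M
}.

Arguments up_0 {T var ren subst up subst1}.
Arguments up_S {T var ren subst up subst1}.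
Arguments subst_var {T var ren subst up subst1}.
Arguments subst_id {T var ren subst up subst1}.
Arguments subst_comp {T var ren subst up subst1}.
Arguments ren_eq_subst {T var ren subst up subst1}.
Arguments subst1_eq_subst {T var ren subst up subst1}.

Section SubstLaws.

Context {T : Type} {var : nat -> T} {ren : (nat -> nat) -> T -> T}.
Context {subst : (nat -> T) -> T -> T} {up : (nat -> T) -> nat -> T}.
Context {subst1 : T -> T -> T}.
Variable laws : subst_laws var ren subst up subst1.

Lemma subst_ext f g M : (forall n, f n = g n) -> subst f M = subst g M.
Proof.
  intros Hfg. rewrite <- (subst_id laws var M) at 1 by reflexivity.
  apply (subst_comp laws). intros n. now rewrite (subst_var laws).
Qed.

Lemma ren_ext r q M : (forall n, r n = q n) -> ren r M = ren q M.
Proof.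
  intros Hrq. rewrite !(ren_eq_subst laws). apply subst_ext.
  intros n. now rewrite Hrq.
Qed.

Lemma subst_ren f r g M :
  (forall n, f (r n) = g n) -> subst f (ren r M) = subst g M.
Proof.
  intros Hg. rewrite (ren_eq_subst laws). apply (subst_comp laws).
  intros n. now rewrite (subst_var laws).
Qed.

Lemma ren_subst r f g M :
  (forall n, ren r (f n) = g n) -> ren r (subst f M) = subst g M.
Proof.
  intros Hg. rewrite (ren_eq_subst laws). apply (subst_comp laws).
  intros n. now rewrite <- (ren_eq_subst laws).
Qed.

Lemma ren_ren r q p M :
  (forall n, r (q n) = p n) -> ren r (ren q M) = ren p M.
Proof.
  intros Hp. rewrite !(ren_eq_subst laws _ M). apply ren_subst.
  intros n. now rewrite (ren_eq_subst laws), (subst_var laws), Hp.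
Qed.

Lemma ren_shift_S n M : ren (shift (S n)) M = ren S (ren (shift n) M).
Proof. symmetry. apply ren_ren. intros; lia. Qed.

Lemma ren_shift_0 M : ren (shift 0) M = ren S M.
Proof. apply ren_ext. intros; lia. Qed.

Lemma subst_up_ren_S f M : subst (up f) (ren S M) = ren S (subst f M).
Proof.
  rewrite (ren_subst _ _ (fun n => ren S (f n))) by reflexivity.
  apply subst_ren. intros n. apply (up_S laws).
Qed.

Lemma subst1_ren_S N M : subst1 N (ren S M) = M.
Proof.
  rewrite (subst1_eq_subst laws), (subst_ren _ _ var) by reflexivity.
  now apply (subst_id laws).
Qed.

Lemma subst_subst1 f N M :
  subst f (subst1 N M) = subst1 (subst f N) (subst (up f) M).
Proof.
  rewrite !(subst1_eq_subst laws). etransitivity.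
  - apply (subst_comp laws). reflexivity.
  - symmetry. apply (subst_comp laws). intros [|n].
    + now rewrite (up_0 laws), (subst_var laws).
    + rewrite (up_S laws), <- (subst1_eq_subst laws), subst1_ren_S.
      now rewrite (subst_var laws).
Qed.

Lemma ren_subst1 r N M :
  ren r (subst1 N M) = subst1 (ren r N) (ren (upren r) M).
Proof.
  rewrite !(ren_eq_subst laws), subst_subst1. f_equal. apply subst_ext.
  intros [|n].
  - apply (up_0 laws).
  - now rewrite (up_S laws), (ren_eq_subst laws), (subst_var laws).
Qed.

Lemma subst1_var_ren_upren M : subst1 (var 0) (ren (upren S) M) = M.
Proof.
  rewrite (subst1_eq_subst laws), (subst_ren _ _ var) by now intros [|n].
  now apply (subst_id laws).
Qed.

End SubstLaws.

Section TypedSubstitution.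

Context {T : Type} {var : nat -> T} {ren : (nat -> nat) -> T -> T}.
Context {subst : (nat -> T) -> T -> T} {up : (nat -> T) -> nat -> T}.
Context {subst1 : T -> T -> T}.
Variable laws : subst_laws var ren subst up subst1.
Variables (wf : list T -> Prop) (ty : list T -> T -> T -> Prop).

Definition typed_subst (G : list T) (f : nat -> T) (G' : list T) : Prop :=
  forall n A, nth_error G n = Some A ->
    ty G' (f n) (subst f (ren (shift n) A)).

Definition typed_renaming (G : list T) (f : nat -> T) (G' : list T) : Prop :=
  forall n A, nth_error G n = Some A ->
    exists k B, f n = var k /\ nth_error G' k = Some B /\
      ren (shift k) B = subst f (ren (shift n) A).

(* Quantifying over classes [K] of substitutions makes weakening and
   substitution two instances of one induction on derivations: lifting a
   well-typed substitution itself requires weakening. *)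
Definition liftable_class
    (K : list T -> (nat -> T) -> list T -> Prop) : Prop :=
  (forall G f G', K G f G' -> wf G' -> typed_subst G f G') /\
  (forall G f G' A, K G f G' -> wf (subst f A :: G') ->
     K (A :: G) (up f) (subst f A :: G')).

Record typing_laws : Prop := {
  ty_wf G M A : ty G M A -> wf G;
  ty_nth G n A :
    wf G -> nth_error G n = Some A -> ty G (var n) (ren (shift n) A);
  ty_subst_class K : liftable_class K -> forall G M A, ty G M A ->
    forall f G', K G f G' -> wf G' -> ty G' (subst f M) (subst f A)
}.

Hypothesis typing : typing_laws.

Lemma typed_renaming_liftable : liftable_class typed_renaming.
Proof.
  split.
  - intros G f G' Hf HG' n A Hn.
    destruct (Hf _ _ Hn) as [k [B [-> [Hk <-]]]]. now apply (ty_nth typing).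
  - intros G f G' A Hf _ [|n] B Hn; simpl in Hn.
    + injection Hn as <-. exists 0, (subst f A). split; [|split; auto].
      * apply (up_0 laws).
      * now rewrite !(ren_shift_0 laws), (subst_up_ren_S laws).
    + destruct (Hf _ _ Hn) as [k [B' [Hfn [Hk HB]]]]. exists (S k), B'.
      split; [|split; auto].
      * now rewrite (up_S laws), Hfn, (ren_eq_subst laws), (subst_var laws).
      * now rewrite !(ren_shift_S laws), HB, (subst_up_ren_S laws).
Qed.

Lemma ty_weaken G M A C :
  ty G M A -> wf (C :: G) -> ty (C :: G) (ren S M) (ren S A).
Proof.
  intros HM HC. rewrite !(ren_eq_subst laws).
  apply (ty_subst_class typing _ typed_renaming_liftable G); auto.
  intros n B Hn. exists (S n), B. split; [reflexivity | split; auto].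
  now rewrite (ren_shift_S laws), <- (ren_eq_subst laws).
Qed.

Lemma typed_subst_liftable : liftable_class typed_subst.
Proof.
  split; auto.
  intros G f G' A Hf HA [|n] B Hn; simpl in Hn.
  - injection Hn as <-.
    rewrite (up_0 laws), (ren_shift_0 laws), (subst_up_ren_S laws).
    rewrite <- (ren_shift_0 laws). now apply (ty_nth typing).
  - rewrite (up_S laws), (ren_shift_S laws), (subst_up_ren_S laws).
    apply ty_weaken; auto.
Qed.

Lemma ty_subst G M A f G' :
  ty G M A -> typed_subst G f G' -> wf G' -> ty G' (subst f M) (subst f A).
Proof.
  intros HM. exact (ty_subst_class typing _ typed_subst_liftable _ _ _ HM _ _).
Qed.

Lemma ty_subst1 G A N M B :
  ty (A :: G) M B -> ty G N A -> ty G (subst1 N M) (subst1 N B).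
Proof.
  intros HM HN. assert (HG := ty_wf typing _ _ _ HN).
  rewrite !(subst1_eq_subst laws). apply (ty_subst _ _ _ _ _ HM); auto.
  intros [|n] C Hn; simpl in Hn; rewrite <- (subst1_eq_subst laws).
  - injection Hn as <-. now rewrite (ren_shift_0 laws), (subst1_ren_S laws).
  - rewrite (ren_shift_S laws), (subst1_ren_S laws).
    now apply (ty_nth typing).
Qed.

Lemma ty_replace_head G A A' M B :
  ty (A :: G) M B -> wf (A' :: G) ->
  ty (A' :: G) (var 0) (ren S A) -> ty (A' :: G) M B.
Proof.
  intros HM HA' Hvar.
  rewrite <- (subst_id laws var M), <- (subst_id laws var B) by reflexivity.
  apply (ty_subst _ _ _ _ _ HM); auto.
  intros [|n] C Hn; simpl in Hn; rewrite (subst_id laws) by reflexivity.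
  - injection Hn as <-. now rewrite (ren_shift_0 laws).
  - now apply (ty_nth typing).
Qed.

End TypedSubstitution.

(** * Substitution in Dedukti and EPTS terms *)

Lemma dterm_In_ind {C : Type} {ar : C -> nat} (Q : dterm ar -> Prop) :
  (forall n, Q (dVar n)) ->
  (forall c (v : Vector.t (dterm ar) (ar c)),
     (forall a, Vector.In a v -> Q a) -> Q (dCst c v)) ->
  (forall s, Q (dSort s)) ->
  (forall M N, Q M -> Q N -> Q (dApp M N)) ->
  (forall A M, Q A -> Q M -> Q (dLam A M)) ->
  (forall A B, Q A -> Q B -> Q (dPi A B)) ->
  forall M, Q M.
Proof.
  intros HVar HCst HSort HApp HLam HPi. fix IH 1.
  intros [n | c v | s | M N | A M | A B];
    [apply HVar | | apply HSort | apply HApp; apply IH | apply HLam; apply IH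
    | apply HPi; apply IH].
  apply HCst, Vector.Forall_forall.
  exact ((fix F n (v : Vector.t (dterm ar) n) : Vector.Forall Q v :=
    match v with
    | Vector.nil _ => Vector.Forall_nil Q
    | Vector.cons _ x _ w => Vector.Forall_cons Q x w (IH x) (F _ w)
    end) _ v).
Qed.

Ltac dterm_induction M :=
  induction M as [n | c v IHv | s | M N IHM IHN | A M IHA IHM | A B IHA IHB]
    using dterm_In_ind.

Section DeduktiSubstitution.

Context {C : Type} {ar : C -> nat}.
Implicit Types (f g h : nat -> dterm ar) (M N : dterm ar).

Lemma dren_dren M : forall q r p,
  (forall n, r (q n) = p n) -> dren r (dren q M) = dren p M.
Proof.
  assert (upren_upren : forall q r p : nat -> nat, (forall n, r (q n) = p n) ->
    forall n, upren r (upren q n) = upren p n).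
  { intros q r p Hp [|n]; simpl; congruence. }
  dterm_induction M; intros q r p Hp; simpl; auto; f_equal; auto.
  rewrite Vector.map_map. apply Vector.map_ext_in; auto.
Qed.

Lemma dsubst_dren M : forall r f g,
  (forall n, f (r n) = g n) -> dsubst f (dren r M) = dsubst g M.
Proof.
  assert (dup_upren : forall r f g, (forall n, f (r n) = g n) ->
    forall n, dup f (upren r n) = dup g n).
  { intros r f g Hg [|n]; simpl; congruence. }
  dterm_induction M; intros r f g Hg; simpl; auto; f_equal; auto.
  rewrite Vector.map_map. apply Vector.map_ext_in; auto.
Qed.

Lemma dren_dsubst M : forall r f g,
  (forall n, dren r (f n) = g n) -> dren r (dsubst f M) = dsubst g M.
Proof.
  assert (upren_dup : forall r f g, (forall n, dren r (f n) = g n) ->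
    forall n, dren (upren r) (dup f n) = dup g n).
  { intros r f g Hg [|n]; simpl; auto. rewrite <- Hg.
    rewrite (dren_dren _ _ _ (fun m => S (r m))) by reflexivity.
    now rewrite (dren_dren _ _ _ (fun m => S (r m))). }
  dterm_induction M; intros r f g Hg; simpl; auto; f_equal; auto.
  rewrite Vector.map_map. apply Vector.map_ext_in; auto.
Qed.

Lemma dsubst_dsubst M : forall f g h,
  (forall n, dsubst g (f n) = h n) -> dsubst g (dsubst f M) = dsubst h M.
Proof.
  assert (dup_dup : forall f g h, (forall n, dsubst g (f n) = h n) ->
    forall n, dsubst (dup g) (dup f n) = dup h n).
  { intros f g h Hh [|n]; simpl; auto. rewrite <- Hh.
    rewrite (dsubst_dren _ _ _ (fun m => dren S (g m))) by reflexivity.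
    now rewrite (dren_dsubst _ _ _ (fun m => dren S (g m))). }
  dterm_induction M; intros f g h Hh; simpl; auto; f_equal; auto.
  rewrite Vector.map_map. apply Vector.map_ext_in; auto.
Qed.

Lemma dsubst_id M : forall f, (forall n, f n = dVar n) -> dsubst f M = M.
Proof.
  assert (dup_id : forall f, (forall n, f n = dVar n) ->
    forall n, dup f n = dVar n).
  { intros f Hf [|n]; simpl; rewrite ?Hf; auto. }
  dterm_induction M; intros f Hf; simpl; auto; f_equal; auto.
  rewrite <- (Vector.map_id _ _ v) at 2. apply Vector.map_ext_in; auto.
Qed.

Lemma dsubst_laws :
  subst_laws (T := dterm ar) dVar dren dsubst dup dsubst1.
Proof.
  split; try reflexivity.
  - intros f M. apply dsubst_id.
  - intros f g h M. apply dsubst_dsubst.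
  - intros r M. rewrite <- (dsubst_id (dren r M) dVar) by reflexivity.
    now apply dsubst_dren.
  - intros N M. rewrite <- (dsubst_id M dVar) at 1 by reflexivity.
    apply dsubst_dsubst. now intros [|[|n]].
Qed.

End DeduktiSubstitution.

Lemma tr_eren {X : Type} (M : eterm X) :
  forall r, tr (eren r M) = dren r (tr M).
Proof.
  induction M; intros r; simpl; rewrite ?IHM1, ?IHM2, ?IHM3, ?IHM4; reflexivity.
Qed.

Lemma tr_esubst {X : Type} (M : eterm X) :
  forall f, tr (esubst f M) = dsubst (fun n => tr (f n)) (tr M).
Proof.
  assert (tr_eup : forall (f : nat -> eterm X) N,
    dsubst (fun n => tr (eup f n)) N = dsubst (dup (fun n => tr (f n))) N).
  { intros f N. apply (subst_ext dsubst_laws). intros [|n]; auto.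
    apply tr_eren. }
  induction M; intros f; simpl; rewrite ?IHM1, ?IHM2, ?IHM3, ?IHM4, ?tr_eup;
    reflexivity.
Qed.

Lemma tr_esubst1 {X : Type} (N M : eterm X) :
  tr (esubst1 N M) = dsubst1 (tr N) (tr M).
Proof.
  unfold esubst1. rewrite tr_esubst, (subst1_eq_subst dsubst_laws).
  apply (subst_ext dsubst_laws). now intros [|n].
Qed.

(* Only the values on the image of [tr] matter; the others are junk. *)
Fixpoint untr {X : Type} (M : dkterm X) : eterm X :=
  match M with
  | dVar n => eVar n
  | dLam _ M => untr M
  | dCst c v =>
      let args := Vector.to_list (Vector.map untr v) in
      match c, args with
      | cu s, nil => eSort s
      | cProd s1 s2, A :: B :: nil => ePi s1 s2 A B
      | cabs s1 s2, A :: B :: M :: nil => eLam s1 s2 A B M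
      | capp s1 s2, A :: B :: M :: N :: nil => eApp s1 s2 A B M N
      | _, _ => eVar 0
      end
  | _ => eVar 0
  end.

Lemma untr_tr {X : Type} (M : eterm X) : untr (tr M) = M.
Proof. induction M; simpl; congruence. Qed.

Lemma tr_inj {X : Type} (M N : eterm X) : tr M = tr N -> M = N.
Proof. intros HMN. now rewrite <- (untr_tr M), HMN, untr_tr. Qed.

(* The laws are inherited from Dedukti terms through the injection [tr]. *)
Lemma esubst_laws {X : Type} :
  subst_laws (T := eterm X) eVar eren esubst eup esubst1.
Proof.
  split; try reflexivity.
  - intros f M Hf. apply tr_inj. rewrite tr_esubst. apply dsubst_id.
    intros n. now rewrite Hf.
  - intros f g h M Hh. apply tr_inj. rewrite !tr_esubst. apply dsubst_dsubst.
    intros n. now rewrite <- tr_esubst, Hh.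
  - intros r M. apply tr_inj. rewrite tr_eren, tr_esubst.
    apply (ren_eq_subst dsubst_laws).
Qed.

(** * Confluence of EPTS reduction *)

Lemma clos_rst_map {X Y : Type} (R : relation X) (Q : relation Y) (F : X -> Y) :
  (forall x y, R x y -> clos_refl_sym_trans _ Q (F x) (F y)) ->
  forall x y, clos_refl_sym_trans _ R x y ->
    clos_refl_sym_trans _ Q (F x) (F y).
Proof.
  intros HF x y Hxy. induction Hxy; [auto | | |].
  - apply rst_refl.
  - now apply rst_sym.
  - eapply rst_trans; eassumption.
Qed.

Ltac rewrite_under R F :=
  apply (clos_rst_map R R F);
    [intros ? ? ?; apply rst_step; constructor; assumption | assumption].

Lemma Rstar_invariant {X : Type} (R : relation X) (Q : X -> Prop) :
  (forall x y, R x y -> Q x -> Q y) ->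
  forall x y, Relations_2.Rstar _ R x y -> Q x -> Q y.
Proof. intros HQ x y Hxy. induction Hxy; eauto. Qed.

Lemma confluent_church_rosser {X : Type} (R : relation X) :
  Relations_3.Confluent _ R ->
  forall x y, clos_refl_sym_trans _ R x y -> Relations_3.coherent _ R x y.
Proof.
  intros HR x y Hxy.
  induction Hxy as [x y Hxy | x | x y _ IH
    | x y z _ [u [Hxu Hyu]] _ [v [Hyv Hzv]]].
  - exists y. split; [|constructor].
    now apply Relations_2_facts.Rstar_contains_R.
  - exists x. split; constructor.
  - now apply Relations_3_facts.coherent_symmetric.
  - destruct (HR _ _ _ Hyu Hyv) as [w [Huw Hvw]].
    exists w. split; eapply Relations_2_facts.Rstar_transitive; eassumption.
Qed.

Inductive epar (P : pts_spec) : eterm (sort P) -> eterm (sort P) -> Prop :=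
| epar_var n : epar P (eVar n) (eVar n)
| epar_sort s : epar P (eSort s) (eSort s)
| epar_pi s1 s2 A A' B B' :
    epar P A A' -> epar P B B' -> epar P (ePi s1 s2 A B) (ePi s1 s2 A' B')
| epar_lam s1 s2 A A' B B' M M' :
    epar P A A' -> epar P B B' -> epar P M M' ->
    epar P (eLam s1 s2 A B M) (eLam s1 s2 A' B' M')
| epar_app s1 s2 A A' B B' M M' N N' :
    epar P A A' -> epar P B B' -> epar P M M' -> epar P N N' ->
    epar P (eApp s1 s2 A B M N) (eApp s1 s2 A' B' M' N')
| epar_beta s1 s2 s3 A B A' B' M M' N N' :
    rul P s1 s2 s3 -> epar P M M' -> epar P N N' ->
    epar P (eApp s1 s2 A B (eLam s1 s2 A' B' M) N) (esubst1 N' M').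

Local Notation epars P := (Relations_2.Rstar _ (epar P)).

Section Confluence.

Context {P : pts_spec}.
Implicit Types (s : sort P) (A B M N L : eterm (sort P)).

Lemma epar_refl M : epar P M M.
Proof. induction M; constructor; assumption. Qed.

Lemma ered_epar M M' : ered P M M' -> epar P M M'.
Proof. induction 1; econstructor; eauto using epar_refl. Qed.

Lemma epar_eren M M' : epar P M M' -> forall r, epar P (eren r M) (eren r M').
Proof.
  induction 1; intros r; simpl; try (constructor; auto; fail).
  rewrite (ren_subst1 esubst_laws). econstructor; eauto.
Qed.

Lemma epar_esubst M M' : epar P M M' ->
  forall f g, (forall n, epar P (f n) (g n)) ->
    epar P (esubst f M) (esubst g M').
Proof.
  assert (epar_eup : forall f g, (forall n, epar P (f n) (g n)) ->
    forall n, epar P (eup f n) (eup g n)).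
  { intros f g Hfg [|n]; simpl; [constructor | now apply epar_eren]. }
  induction 1; intros f g Hfg; simpl; try (constructor; auto; fail).
  - apply Hfg.
  - rewrite (subst_subst1 esubst_laws). econstructor; eauto.
Qed.

Lemma epar_esubst1 M M' N N' :
  epar P M M' -> epar P N N' -> epar P (esubst1 N M) (esubst1 N' M').
Proof.
  intros HM HN. apply epar_esubst; auto.
  intros [|n]; auto. constructor.
Qed.

Lemma epar_lam_inv s1 s2 A B M L :
  epar P (eLam s1 s2 A B M) L ->
  exists A' B' M', L = eLam s1 s2 A' B' M' /\ epar P M M'.
Proof. inversion 1; subst; eauto. Qed.

(* [L] is the complete development of [M]: it contracts all the redexes of [M].
   Whether an application of an abstraction is a redex depends on [rul], hence
   the use of classical logic. *)
Lemma epar_triangle M : exists L, forall N, epar P M N -> epar P N L.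
Proof.
  induction M as [n | s | s1 s2 A [A' HA] B [B' HB]
    | s1 s2 A [A' HA] B [B' HB] M [M' HM]
    | s1 s2 A [A' HA] B [B' HB] M [M' HM] N [N' HN]].
  - exists (eVar n). inversion 1; constructor.
  - exists (eSort s). inversion 1; constructor.
  - exists (ePi s1 s2 A' B'). inversion 1; subst; constructor; auto.
  - exists (eLam s1 s2 A' B' M'). inversion 1; subst; constructor; auto.
  - destruct (classic (exists s3 A0 B0 M0,
      rul P s1 s2 s3 /\ M = eLam s1 s2 A0 B0 M0))
      as [[s3 [A0 [B0 [M0 [Hrul ->]]]]] | Hnoredex].
    + destruct (epar_lam_inv _ _ _ _ _ _ (HM _ (epar_refl _)))
        as [A1 [B1 [M1 [-> _]]]].
      assert (HM0 : forall M2, epar P M0 M2 -> epar P M2 M1).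
      { intros M2 HM2. specialize (HM (eLam s1 s2 A0 B0 M2)).
        enough (HL : epar P (eLam s1 s2 A0 B0 M2) (eLam s1 s2 A1 B1 M1))
          by now inversion HL.
        apply HM. constructor; auto using epar_refl. }
      exists (esubst1 N' M1). intros L HL. inversion HL as
        [| | | | ? ? ? ? ? ? ? L0 ? N0 _ _ HL0 HN0 | ? ? ? ? ? ? ? ? M2 ? N2];
        subst.
      * apply epar_lam_inv in HL0 as [A2 [B2 [M2 [-> HM2]]]].
        apply epar_beta with s3; auto.
      * apply epar_esubst1; auto.
    + exists (eApp s1 s2 A' B' M' N'). inversion 1; subst.
      * constructor; auto.
      * exfalso. eauto 10.
Qed.

Lemma epar_confluent : Relations_3.Confluent _ (epar P).
Proof.
  apply Relations_3_facts.Strong_confluence. intros M N1 N2 HN1 HN2.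
  destruct (epar_triangle M) as [L HL]. exists L; auto.
Qed.

Lemma econv_church_rosser M N :
  econv P M N -> Relations_3.coherent _ (epar P) M N.
Proof.
  intros HMN. apply (confluent_church_rosser _ epar_confluent).
  revert HMN. apply (clos_rst_map (ered P) (epar P) (fun X => X)).
  intros M' N' HMN'. now apply rst_step, ered_epar.
Qed.

Lemma econv_pi s1 s2 A A' B B' :
  econv P A A' -> econv P B B' -> econv P (ePi s1 s2 A B) (ePi s1 s2 A' B').
Proof.
  intros HA HB. apply rst_trans with (ePi s1 s2 A' B).
  - rewrite_under (ered P) (fun X => ePi s1 s2 X B).
  - rewrite_under (ered P) (fun X => ePi s1 s2 A' X).
Qed.

Lemma econv_lam s1 s2 A A' B B' M M' :
  econv P A A' -> econv P B B' -> econv P M M' ->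
  econv P (eLam s1 s2 A B M) (eLam s1 s2 A' B' M').
Proof.
  intros HA HB HM. apply rst_trans with (eLam s1 s2 A' B M);
    [|apply rst_trans with (eLam s1 s2 A' B' M)].
  - rewrite_under (ered P) (fun X => eLam s1 s2 X B M).
  - rewrite_under (ered P) (fun X => eLam s1 s2 A' X M).
  - rewrite_under (ered P) (fun X => eLam s1 s2 A' B' X).
Qed.

Lemma econv_app s1 s2 A A' B B' M M' N N' :
  econv P A A' -> econv P B B' -> econv P M M' -> econv P N N' ->
  econv P (eApp s1 s2 A B M N) (eApp s1 s2 A' B' M' N').
Proof.
  intros HA HB HM HN. apply rst_trans with (eApp s1 s2 A' B M N);
    [|apply rst_trans with (eApp s1 s2 A' B' M N);
      [|apply rst_trans with (eApp s1 s2 A' B' M' N)]].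
  - rewrite_under (ered P) (fun X => eApp s1 s2 X B M N).
  - rewrite_under (ered P) (fun X => eApp s1 s2 A' X M N).
  - rewrite_under (ered P) (fun X => eApp s1 s2 A' B' X N).
  - rewrite_under (ered P) (fun X => eApp s1 s2 A' B' M' X).
Qed.

Lemma epar_econv M M' : epar P M M' -> econv P M M'.
Proof.
  induction 1 as [| | | | | s1 s2 s3 A B A' B' M M' N N' Hrul _ IHM _ IHN];
    auto using econv_pi, econv_lam, econv_app; try apply rst_refl.
  apply rst_trans with (eApp s1 s2 A B (eLam s1 s2 A' B' M') N').
  - apply econv_app; try apply econv_lam; auto; apply rst_refl.
  - apply rst_step. econstructor; eassumption.
Qed.

Lemma econv_esubst f M M' :
  econv P M M' -> econv P (esubst f M) (esubst f M').
Proof.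
  apply clos_rst_map. intros N N' HN.
  apply epar_econv, epar_esubst; auto using ered_epar, epar_refl.
Qed.

Lemma epars_sort_inv s M :
  epars P (eSort s) M -> M = eSort s.
Proof.
  intros HM. apply (Rstar_invariant _ (fun N => N = eSort s)) in HM; auto.
  intros N N' HN ->. now inversion HN.
Qed.

Lemma epars_pi_inv s1 s2 A B M :
  epars P (ePi s1 s2 A B) M ->
  exists A' B', M = ePi s1 s2 A' B' /\ econv P A A' /\ econv P B B'.
Proof.
  intros HM. apply (Rstar_invariant _ (fun N =>
    exists A' B', N = ePi s1 s2 A' B' /\ econv P A A' /\ econv P B B')) in HM;
    auto.
  - intros N N' HN [A' [B' [-> [HA HB]]]].
    inversion HN as [| | ? ? ? A'' ? B'' HA' HB' | | |]; subst.
    exists A'', B''. split; [reflexivity | split].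
    + apply rst_trans with A'; [exact HA | now apply epar_econv].
    + apply rst_trans with B'; [exact HB | now apply epar_econv].
  - exists A, B. repeat split; apply rst_refl.
Qed.

Lemma econv_sort_epars s M :
  econv P M (eSort s) -> epars P M (eSort s).
Proof.
  intros HM. destruct (econv_church_rosser _ _ HM) as [L [HML HsL]].
  now apply epars_sort_inv in HsL as ->.
Qed.

Lemma econv_sort_inj s s' : econv P (eSort s) (eSort s') -> s = s'.
Proof.
  intros Hs. apply econv_sort_epars, epars_sort_inv in Hs. congruence.
Qed.

Lemma econv_pi_inj s1 s2 A B t1 t2 A' B' :
  econv P (ePi s1 s2 A B) (ePi t1 t2 A' B') -> econv P A A' /\ econv P B B'.
Proof.
  intros Hpi. destruct (econv_church_rosser _ _ Hpi) as [L [HL HL']].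
  apply epars_pi_inv in HL as [A1 [B1 [-> [HA HB]]]].
  apply epars_pi_inv in HL' as [A2 [B2 [E [HA' HB']]]].
  injection E as <- <- <- <-.
  split; eapply rst_trans; eauto using rst_sym.
Qed.

End Confluence.

(** * Metatheory of EPTS typing *)

Section EPTSTyping.

Context {P : pts_spec}.
Implicit Types (G : ectx P) (s : sort P) (A B M N : eterm (sort P)).

Lemma ety_ewf G M A : ety P G M A -> ewf P G.
Proof. induction 1; auto. Qed.

Lemma ety_typing_laws :
  typing_laws (T := eterm (sort P)) (var := eVar) (ren := eren)
    (subst := esubst) (up := eup) (ewf P) (ety P).
Proof.
  split; [exact ety_ewf | exact (ety_var P) |].
  intros K [HK Hlift] G M A HM.
  induction HM as [G M A B s _ IHM _ IHB HAB | G s1 s2 HG Hs | G n A HG Hn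
    | G s1 s2 s3 A B Hrul _ IHA _ IHB
    | G s1 s2 s3 A B M Hrul _ IHA _ IHB _ IHM
    | G s1 s2 s3 A B M N Hrul _ IHA _ IHB _ IHN _ IHM];
    intros f G' Hf HG'; simpl;
    try assert (HAG' : ewf P (esubst f A :: G'))
      by (econstructor; now apply (IHA f)).
  - eapply ety_conv; [apply IHM | apply (IHB f) | apply econv_esubst]; auto.
  - now constructor.
  - now apply (HK G).
  - eapply ety_pi; [exact Hrul | apply (IHA f) | apply (IHB (eup f))]; auto.
  - eapply ety_lam;
      [exact Hrul | apply (IHA f) | apply (IHB (eup f)) | apply IHM]; auto.
  - rewrite (subst_subst1 esubst_laws).
    eapply ety_app; [exact Hrul | apply (IHA f) | apply (IHB (eup f))
      | apply IHN | apply IHM]; auto.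
Qed.

Lemma ety_weaken G M A C :
  ety P G M A -> ewf P (C :: G) -> ety P (C :: G) (eren S M) (eren S A).
Proof. exact (ty_weaken esubst_laws _ _ ety_typing_laws G M A C). Qed.

Lemma ety_esubst1 G A N M B :
  ety P (A :: G) M B -> ety P G N A -> ety P G (esubst1 N M) (esubst1 N B).
Proof. exact (ty_subst1 esubst_laws _ _ ety_typing_laws G A N M B). Qed.

Lemma ety_ctx_conv G A A' s s' M B :
  ety P (A :: G) M B -> ety P G A (eSort s) -> ety P G A' (eSort s') ->
  econv P A A' -> ety P (A' :: G) M B.
Proof.
  intros HM HA HA' HAA'.
  assert (HG : ewf P (A' :: G)) by (econstructor; eassumption).
  apply (ty_replace_head esubst_laws _ _ ety_typing_laws _ _ _ _ _ HM HG).
  apply ety_conv with (eren S A') s.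
  - rewrite <- (ren_shift_0 esubst_laws). now constructor.
  - exact (ety_weaken _ _ _ _ HA HG).
  - rewrite !(ren_eq_subst esubst_laws). now apply econv_esubst, rst_sym.
Qed.

Lemma ewf_nth G n A :
  ewf P G -> nth_error G n = Some A ->
  exists s, ety P G (eren (shift n) A) (eSort s).
Proof.
  intros HG. revert n A.
  induction G as [|C G IH]; intros [|n] A Hn; try discriminate;
    simpl in Hn; inversion HG as [|? ? s HC]; subst.
  - injection Hn as <-. exists s. rewrite (ren_shift_0 esubst_laws).
    exact (ety_weaken _ _ _ _ HC HG).
  - destruct (IH (ety_ewf _ _ _ HC) _ _ Hn) as [s' Hs']. exists s'.
    rewrite (ren_shift_S esubst_laws). exact (ety_weaken _ _ _ _ Hs' HG).
Qed.

Lemma ety_type_correct G M A :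
  ety P G M A ->
  (exists s, A = eSort s) \/ (exists s, ety P G A (eSort s)).
Proof.
  intros HM. destruct HM as [G M A B s _ HB _ | G s1 s2 _ _ | G n A HG Hn
    | G s1 s2 s3 A B _ _ _ | G s1 s2 s3 A B M Hrul HA HB _
    | G s1 s2 s3 A B M N _ _ HB HN _]; eauto.
  - right. now apply ewf_nth.
  - right. exists s3. now apply ety_pi.
  - right. exists s2. exact (ety_esubst1 _ _ _ _ _ HB HN).
Qed.

Inductive principal_type G : eterm (sort P) -> eterm (sort P) -> Prop :=
| principal_var n A :
    nth_error G n = Some A -> principal_type G (eVar n) (eren (shift n) A)
| principal_sort s1 s2 : axm P s1 s2 -> principal_type G (eSort s1) (eSort s2)
| principal_pi s1 s2 s3 A B :
    rul P s1 s2 s3 -> principal_type G (ePi s1 s2 A B) (eSort s3)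
| principal_lam s1 s2 A B M :
    principal_type G (eLam s1 s2 A B M) (ePi s1 s2 A B)
| principal_app s1 s2 A B M N :
    principal_type G (eApp s1 s2 A B M N) (esubst1 N B).

Lemma principal_type_exists G M A :
  ety P G M A -> exists A0, principal_type G M A0 /\ econv P A0 A.
Proof.
  induction 1 as [G M A B s _ [A0 [HA0 HA]] _ _ HAB | | | | |];
    [|eexists; split; [econstructor; eassumption | apply rst_refl] ..].
  exists A0. split; auto. eapply rst_trans; eassumption.
Qed.

Lemma principal_type_unique (HP : functional_pts P) G M A B :
  principal_type G M A -> principal_type G M B -> A = B.
Proof.
  destruct HP as [Haxm Hrul].
  intros HA HB. destruct HA; inversion HB; subst; f_equal; eauto; congruence.
Qed.

Lemma ety_unique (HP : functional_pts P) G M A B :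
  ety P G M A -> ety P G M B -> econv P A B.
Proof.
  intros HA HB.
  destruct (principal_type_exists _ _ _ HA) as [A0 [HA0 HAA0]].
  destruct (principal_type_exists _ _ _ HB) as [B0 [HB0 HBB0]].
  rewrite (principal_type_unique HP _ _ _ _ HB0 HA0) in HBB0.
  eapply rst_trans; [apply rst_sym|]; eassumption.
Qed.

Lemma ety_unique_sort (HP : functional_pts P) G M s s' :
  ety P G M (eSort s) -> ety P G M (eSort s') -> s = s'.
Proof. intros Hs Hs'. eapply econv_sort_inj, ety_unique; eassumption. Qed.

Lemma ety_sort_axm G s s' : ety P G (eSort s) (eSort s') -> axm P s s'.
Proof.
  intros Hs. destruct (principal_type_exists _ _ _ Hs) as [A [HA HAs']].
  inversion HA; subst. now apply econv_sort_inj in HAs' as <-.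
Qed.

Lemma ety_conv_pi G s1 s2 s3 A A' B B' M :
  rul P s1 s2 s3 -> ety P G A' (eSort s1) -> ety P (A' :: G) B' (eSort s2) ->
  econv P A A' -> econv P B B' ->
  ety P G M (ePi s1 s2 A B) -> ety P G M (ePi s1 s2 A' B').
Proof.
  intros Hrul HA' HB' HAA' HBB' HM. apply ety_conv with (ePi s1 s2 A B) s3.
  - exact HM.
  - now apply ety_pi.
  - now apply econv_pi.
Qed.

Lemma ety_lam_inv G s1 s2 A B M C :
  ety P G (eLam s1 s2 A B M) C ->
  ety P G A (eSort s1) /\ ety P (A :: G) B (eSort s2) /\
  ety P (A :: G) M B /\ econv P (ePi s1 s2 A B) C.
Proof.
  intros HM. remember (eLam s1 s2 A B M) as L eqn:HL.
  induction HM as [G L C D s _ IH _ _ HCD | | | | |]; try discriminate.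
  - destruct (IH HL) as [HA [HB [HM HC]]]. repeat split; auto.
    eapply rst_trans; eassumption.
  - injection HL as -> -> -> -> ->. repeat split; auto. apply rst_refl.
Qed.

Lemma ety_beta G s1 s2 s A A' B B' M N :
  ety P G (eLam s1 s2 A' B' M) (ePi s1 s2 A B) -> ety P G N A ->
  ety P G (esubst1 N B) (eSort s) -> ety P G (esubst1 N M) (esubst1 N B).
Proof.
  intros HL HN HBN. apply ety_lam_inv in HL as [HA' [HB' [HM Hpi]]].
  apply econv_pi_inj in Hpi as [HAA' HBB'].
  apply ety_conv with (esubst1 N B') s; auto.
  - apply ety_esubst1 with A'; auto.
    apply ety_conv with A s1; auto. now apply rst_sym.
  - now apply econv_esubst.
Qed.

(* Parallel steps contract several redexes at once, so that each congruence rule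
   gives a single case. *)
Lemma subject_reduction_epar G M A :
  ety P G M A -> forall M', epar P M M' -> ety P G M' A.
Proof.
  induction 1 as [G M A B s HM IHM HB _ HAB | |
    | G s1 s2 s3 A B Hrul HA IHA HB IHB
    | G s1 s2 s3 A B M Hrul HA IHA HB IHB HM IHM
    | G s1 s2 s3 A B M N Hrul HA IHA HB IHB HN IHN HM IHM];
    intros L HL.
  - eauto using ety_conv.
  - inversion HL; subst. now constructor.
  - inversion HL; subst. now constructor.
  - inversion HL as [| | ? ? ? A' ? B' HAA' HBB' | | |]; subst.
    apply ety_pi; eauto using ety_ctx_conv, epar_econv.
  - inversion HL as [| | | ? ? ? A' ? B' ? M' HAA' HBB' HMM' | |]; subst.
    apply ety_conv_pi with s3 A' B'; try apply rst_sym, epar_econv; auto.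
    apply ety_lam with s3; eauto using ety_ctx_conv, epar_econv.
    apply ety_ctx_conv with A s1 s1; auto using epar_econv.
    apply ety_conv with B s2; auto using epar_econv.
  - assert (HBN : ety P G (esubst1 N B) (eSort s2))
      by exact (ety_esubst1 _ _ _ _ _ HB HN).
    inversion HL as [| | | | ? ? ? A' ? B' ? M' ? N' HAA' HBB' HMM' HNN'
      | ? ? t3 ? ? A' B' M0 M' ? N' Ht3 HMM' HNN']; subst.
    + assert (HB' : ety P (A' :: G) B' (eSort s2))
        by eauto using ety_ctx_conv, epar_econv.
      apply ety_conv with (esubst1 N' B') s2; auto.
      * apply ety_app with s3; auto.
        -- apply ety_conv with A s1; auto using epar_econv.
        -- apply ety_conv_pi with s3 A B; auto using epar_econv.
      * now apply rst_sym, epar_econv, epar_esubst1.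
    + assert (HBN' : econv P (esubst1 N' B) (esubst1 N B))
        by now apply rst_sym, epar_econv, epar_esubst1; [apply epar_refl|].
      apply ety_conv with (esubst1 N' B) s2; auto.
      apply (ety_beta _ s1 s2 s2 A A' B B'); auto.
      * apply IHM. constructor; auto using epar_refl.
      * apply (ety_esubst1 _ A N' B (eSort s2)); auto.
Qed.

Lemma subject_reduction_epars G M M' A :
  epars P M M' -> ety P G M A -> ety P G M' A.
Proof.
  apply (Rstar_invariant _ (fun N => ety P G N A)). intros N N' HN HNA.
  now apply subject_reduction_epar with N.
Qed.

Lemma ety_econv_sort (HP : functional_pts P) G M A B s :
  ety P G M A -> econv P A B -> ety P G B (eSort s) -> ety P G A (eSort s).
Proof.
  intros HM HAB HB. destruct (ety_type_correct _ _ _ HM) as [[t ->] | [t HA]].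
  - apply rst_sym, econv_sort_epars in HAB.
    exact (subject_reduction_epars _ _ _ _ HAB HB).
  - destruct (econv_church_rosser _ _ HAB) as [L [HAL HBL]].
    assert (t = s) as <-; auto.
    apply (ety_unique_sort HP G L); eauto using subject_reduction_epars.
Qed.

End EPTSTyping.

(** * Metatheory of Dedukti typing *)

Lemma vector_map_replace {X Y : Type} (f : X -> Y) {n} (v : Vector.t X n) i x :
  Vector.map f (Vector.replace v i x) = Vector.replace (Vector.map f v) i (f x).
Proof.
  apply Vector.eq_nth_iff. intros j _ <-.
  rewrite (Vector.nth_map _ _ _ _ eq_refl).
  destruct (Fin.eq_dec j i) as [-> | Hij].
  - now rewrite !Vector.nth_replace_eq.
  - rewrite !Vector.nth_replace_neq by assumption.
    now rewrite (Vector.nth_map _ _ _ _ eq_refl).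
Qed.

Lemma vector_Forall2_replace {X : Type} (Q : X -> X -> Prop) {n}
    (v w : Vector.t X n) :
  Vector.Forall2 Q v w -> forall R : relation (Vector.t X n),
  reflexive _ R -> transitive _ R ->
  (forall u i x, Q (Vector.nth u i) x -> R u (Vector.replace u i x)) ->
  R v w.
Proof.
  induction 1 as [|n x y v w Hxy _ IH]; intros R Hrefl Htrans HR.
  - apply Hrefl.
  - apply Htrans with (Vector.cons _ y _ v).
    + exact (HR (Vector.cons _ x _ v) Fin.F1 y Hxy).
    + apply (IH (fun u u' => R (Vector.cons _ y _ u) (Vector.cons _ y _ u'))).
      * intros u. apply Hrefl.
      * intros u u' u''. apply Htrans.
      * intros u i z. exact (HR (Vector.cons _ y _ u) (Fin.FS i) z).
Qed.

Section DeduktiConversion.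

Context {C : Type} {ar : C -> nat} (T : dtheory ar).
Implicit Types (A B M N : dterm ar).

Lemma dconv_cst c (v w : Vector.t (dterm ar) (ar c)) :
  Vector.Forall2 (dconv T) v w -> dconv T (dCst c v) (dCst c w).
Proof.
  intros Hvw. apply (vector_Forall2_replace _ _ _ Hvw
    (fun u u' => dconv T (dCst c u) (dCst c u'))).
  - intros u. apply rst_refl.
  - intros u1 u2 u3. apply rst_trans.
  - intros u i M HM. rewrite <- (Vector.replace_id _ _ i u) at 1.
    revert HM. apply (clos_rst_map (dred T) (dred T)
      (fun N => dCst c (Vector.replace u i N))).
    intros N N' HN. apply rst_step.
    rewrite <- (Vector.replace_replace_eq _ _ i u N N'). constructor.
    now rewrite Vector.nth_replace_eq.
Qed.

Lemma dconv_lam A A' M M' :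
  dconv T A A' -> dconv T M M' -> dconv T (dLam A M) (dLam A' M').
Proof.
  intros HA HM. apply rst_trans with (dLam A' M).
  - rewrite_under (dred T) (fun X => dLam X M).
  - rewrite_under (dred T) (fun X => dLam A' X).
Qed.

Lemma dred_dsubst M M' :
  dred T M M' -> forall f, dred T (dsubst f M) (dsubst f M').
Proof.
  induction 1 as [| l r g Hlr | | | | | | |]; intros f; simpl;
    try (constructor; auto; fail).
  - rewrite (subst_subst1 dsubst_laws). constructor.
  - rewrite !(dsubst_dsubst _ g f (fun n => dsubst f (g n))) by reflexivity.
    now constructor.
  - rewrite vector_map_replace. constructor.
    now rewrite (Vector.nth_map _ _ _ _ eq_refl).
Qed.

Lemma dconv_dsubst f M M' :
  dconv T M M' -> dconv T (dsubst f M) (dsubst f M').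
Proof.
  apply clos_rst_map. intros N N' HN. now apply rst_step, dred_dsubst.
Qed.

Lemma dconv_eta_lam A M : dconv T (dApp (dren S (dLam A M)) (dVar 0)) M.
Proof.
  apply rst_step. simpl.
  rewrite <- (subst1_var_ren_upren dsubst_laws M) at 2. constructor.
Qed.

End DeduktiConversion.

Scheme dty_dinst_ind := Minimality for dty Sort Prop
  with dinst_dty_ind := Minimality for dinst Sort Prop.

(* A semantic rendering of "every free variable of [M] is smaller than [k]". *)
Definition dbounded {C : Type} {ar : C -> nat} (k : nat) (M : dterm ar)
  : Prop :=
  forall f g, (forall n, n < k -> f n = g n) -> dsubst f M = dsubst g M.

Section DeduktiTyping.

Context {C : Type} {ar : C -> nat} {T : dtheory ar}.
Implicit Types (G D : list (dterm ar)) (A B M N : dterm ar).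

Lemma dbounded_dsubst_dup k M f g :
  dbounded (S k) M -> (forall n, n < k -> f n = g n) ->
  dsubst (dup f) M = dsubst (dup g) M.
Proof.
  intros HM Hfg. apply HM. intros [|n] Hn; simpl; auto.
  rewrite Hfg; auto with arith.
Qed.

Lemma dsubst_dsubstl f l A :
  dbounded (length l) A ->
  dsubst f (dsubstl l A) = dsubstl (map (dsubst f) l) A.
Proof.
  intros HA. unfold dsubstl at 1.
  rewrite (dsubst_dsubst _ _ f _ (fun n => eq_refl)).
  apply HA. intros n Hn. rewrite nth_error_map.
  destruct (nth_error l n) eqn:Hln; simpl; auto.
  apply nth_error_None in Hln. lia.
Qed.

Lemma dty_dwf G M A : dty T G M A -> dwf T G.
Proof.
  intros HM.
  induction HM using dty_dinst_ind with (P0 := fun G _ _ => dwf T G); auto.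
Qed.

Lemma dinst_length G l D : dinst T G l D -> length l = length D.
Proof. induction 1; simpl; congruence. Qed.

Lemma dty_dbounded G M A : dty T G M A -> dbounded (length G) M.
Proof.
  intros HM. induction HM as [| | G n A _ Hn | G c v D A s _ _ _ _ IHv
    | G A B s _ IHA _ IHB | G A B M s _ IHA _ _ _ IHM
    | G A B M N _ IHM _ IHN | | G l D N A _ IHl _ IHN]
    using dty_dinst_ind with
    (P0 := fun G l D => forall N, In N l -> dbounded (length G) N); auto;
    try (intros f g Hfg; simpl; f_equal; auto; fail).
  - intros f g Hfg. apply Hfg. apply nth_error_Some. congruence.
  - intros f g Hfg. simpl. f_equal. apply Vector.map_ext_in. intros N HN.
    apply IHv; auto. rewrite <- in_rev. now apply Vector.to_list_In.
  - intros f g Hfg. simpl. f_equal; auto.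
    now apply (dbounded_dsubst_dup (length G)).
  - intros f g Hfg. simpl. f_equal; auto.
    now apply (dbounded_dsubst_dup (length G)).
  - intros N [].
  - intros N' [<- | HN']; auto.
Qed.

(* The parameter context of a constant in use is well-formed, hence closed:
   substitution leaves it unchanged. *)
Lemma dty_typing_laws :
  typing_laws (T := dterm ar) (var := dVar) (ren := dren)
    (subst := dsubst) (up := dup) (dwf T) (dty T).
Proof.
  split; [exact dty_dwf | exact (dty_var T) |].
  intros K [HK Hlift] G M A HM.
  induction HM as [G M A B s _ IHM _ IHB HAB | G HG | G n A HG Hn
    | G c v D A s Hc HA _ Hv IHv
    | G A B s _ IHA _ IHB
    | G A B M s _ IHA _ IHB _ IHM
    | G A B M N _ IHM _ IHN
    | G HG
    | G l D N A Hl IHl _ IHN]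
    using dty_dinst_ind with
    (P0 := fun G l D => dwf T D -> forall f G', K G f G' -> dwf T G' ->
             dinst T G' (map (dsubst f) l) D);
    [intros f G' Hf HG' .. | intros _ f G' _ HG' | intros HD f G' Hf HG'].
  - eapply dty_conv; [apply IHM | apply (IHB f) | apply dconv_dsubst]; eauto.
  - now constructor.
  - now apply (HK G).
  - rewrite dsubst_dsubstl
      by (rewrite (dinst_length _ _ _ Hv); exact (dty_dbounded _ _ _ HA)).
    specialize (IHv (dty_dwf _ _ _ HA) f G' Hf HG').
    rewrite map_rev, <- Vector.to_list_map in IHv |- *.
    eapply dty_cst; eauto.
  - assert (dwf T (dsubst f A :: G')) by (constructor; now apply (IHA f)).
    eapply dty_pi; [apply (IHA f) | apply (IHB (dup f))]; auto.
  - assert (dwf T (dsubst f A :: G')) by (constructor; now apply (IHA f)).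
    eapply dty_lam; [apply (IHA f) | apply (IHB (dup f)) | apply IHM]; auto.
  - rewrite (subst_subst1 dsubst_laws).
    eapply dty_app; [apply (IHM f) | apply (IHN f)]; auto.
  - now constructor.
  - inversion HD as [|? ? HA]; subst.
    simpl. constructor; [exact (IHl (dty_dwf _ _ _ HA) f G' Hf HG') |].
    rewrite <- dsubst_dsubstl
      by (rewrite (dinst_length _ _ _ Hl); exact (dty_dbounded _ _ _ HA)).
    now apply IHN.
Qed.

Lemma dty_weaken G M A B :
  dty T G M A -> dwf T (B :: G) -> dty T (B :: G) (dren S M) (dren S A).
Proof. exact (ty_weaken dsubst_laws _ _ dty_typing_laws G M A B). Qed.

Lemma dty_dsubst1 G A N M B :
  dty T (A :: G) M B -> dty T G N A -> dty T G (dsubst1 N M) (dsubst1 N B).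
Proof. exact (ty_subst1 dsubst_laws _ _ dty_typing_laws G A N M B). Qed.

Lemma dty_var0 G A : dwf T (A :: G) -> dty T (A :: G) (dVar 0) (dren S A).
Proof.
  intros HA. rewrite <- (ren_shift_0 dsubst_laws). now constructor.
Qed.

End DeduktiTyping.

(** * The encoding of EPTS in Dedukti *)

Section Encoding.

Context {P : pts_spec}.
Local Notation DK := (epts_theory P).
Implicit Types (s : sort P) (D : list (dkterm (sort P))).
Implicit Types (A B M N : dkterm (sort P)).

Lemma dconv_El s A A' : dconv DK A A' -> dconv DK (dEl s A) (dEl s A').
Proof.
  intros HA. apply (dconv_cst DK (cEl s)).
  constructor; [exact HA | constructor].
Qed.

Lemma dconv_El_u s1 s2 : axm P s1 s2 -> dconv DK (dEl s2 (du s1)) (dU s1).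
Proof.
  intros Haxm. apply rst_step.
  exact (dred_rule DK _ _ dVar (rule_El P _ _ Haxm)).
Qed.

Lemma dred_app_abs s1 s2 s3 A B A' B' M N :
  rul P s1 s2 s3 ->
  dred DK (dapp s1 s2 A B (dabs s1 s2 A' B' M) N) (dApp M N).
Proof.
  intros Hrul.
  exact (dred_rule DK _ _
    (fun n => nth n (A :: B :: A' :: B' :: M :: N :: nil) (dVar 0))
    (rule_app P _ _ _ Hrul)).
Qed.

Lemma dty_U D s : dwf DK D -> dty DK D (dU s) (dSort TYPE).
Proof.
  intros HD.
  exact (dty_cst DK D (cU s) []%vector nil (dSort TYPE) KIND
    (sig_U P s) (dty_sort _ _ (dwf_nil _)) (dinst_nil _ _ HD)).
Qed.

Lemma dty_El D s A : dty DK D A (dU s) -> dty DK D (dEl s A) (dSort TYPE).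
Proof.
  intros HA.
  refine (dty_cst DK D (cEl s) [A]%vector _ (dSort TYPE) KIND
    (sig_El P s) (dty_sort _ _ _) _).
  - apply dwf_cons, dty_U, dwf_nil.
  - apply dinst_cons; [apply dinst_nil; exact (dty_dwf _ _ _ HA) | exact HA].
Qed.

Lemma dty_u D s1 s2 :
  axm P s1 s2 -> dwf DK D -> dty DK D (du s1) (dU s2).
Proof.
  intros Haxm HD.
  exact (dty_cst DK D (cu s1) []%vector nil (dU s2) TYPE
    (sig_u P s1 s2 Haxm) (dty_U _ _ (dwf_nil _)) (dinst_nil _ _ HD)).
Qed.

Lemma dty_El_pi D s1 s2 A :
  dty DK D A (dU s1) -> dty DK D (dPi (dEl s1 A) (dU s2)) (dSort TYPE).
Proof.
  intros HA. apply dty_pi; [now apply dty_El | apply dty_U, dwf_cons].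
  now apply dty_El.
Qed.

Lemma dty_El_app D s1 s2 A B N :
  dty DK D B (dPi (dEl s1 A) (dU s2)) -> dty DK D N (dEl s1 A) ->
  dty DK D (dEl s2 (dApp B N)) (dSort TYPE).
Proof.
  intros HB HN. apply dty_El. exact (dty_app DK _ _ _ _ _ HB HN).
Qed.

Lemma dty_El_app_var0 D s1 s2 A B :
  dty DK D A (dU s1) -> dty DK D B (dPi (dEl s1 A) (dU s2)) ->
  dty DK (dEl s1 A :: D) (dEl s2 (dApp (dren S B) (dVar 0))) (dSort TYPE).
Proof.
  intros HA HB.
  assert (HD : dwf DK (dEl s1 A :: D)) by now apply dwf_cons, dty_El.
  apply (dty_El_app _ s1 s2 (dren S A)).
  - exact (dty_weaken _ _ _ _ HB HD).
  - exact (dty_var0 _ _ HD).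
Qed.

Definition Prod_ctx s1 s2 : list (dkterm (sort P)) :=
  dPi (dEl s1 (dVar 0)) (dU s2) :: dU s1 :: nil.

Definition abs_ctx s1 s2 : list (dkterm (sort P)) :=
  dPi (dEl s1 (dVar 1)) (dEl s2 (dApp (dVar 1) (dVar 0))) :: Prod_ctx s1 s2.

Definition app_ctx s1 s2 s3 : list (dkterm (sort P)) :=
  dEl s1 (dVar 2) :: dEl s3 (dProd s1 s2 (dVar 1) (dVar 0)) :: Prod_ctx s1 s2.

Lemma dwf_Prod_ctx s1 s2 : dwf DK (Prod_ctx s1 s2).
Proof.
  apply dwf_cons, dty_El_pi. apply (dty_var0 nil (dU s1)).
  apply dwf_cons, dty_U, dwf_nil.
Qed.

Lemma dinst_Prod_ctx D s1 s2 A B :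
  dty DK D A (dU s1) -> dty DK D B (dPi (dEl s1 A) (dU s2)) ->
  dinst DK D (B :: A :: nil) (Prod_ctx s1 s2).
Proof.
  intros HA HB. apply dinst_cons; [|exact HB].
  apply dinst_cons; [apply dinst_nil; exact (dty_dwf _ _ _ HA) | exact HA].
Qed.

Lemma dty_Prod D s1 s2 s3 A B :
  rul P s1 s2 s3 ->
  dty DK D A (dU s1) -> dty DK D B (dPi (dEl s1 A) (dU s2)) ->
  dty DK D (dProd s1 s2 A B) (dU s3).
Proof.
  intros Hrul HA HB.
  exact (dty_cst DK D (cProd s1 s2) [A; B]%vector _ (dU s3) TYPE
    (sig_Prod P _ _ _ Hrul) (dty_U _ _ (dwf_Prod_ctx _ _))
    (dinst_Prod_ctx _ _ _ _ _ HA HB)).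
Qed.

Lemma dwf_abs_ctx s1 s2 : dwf DK (abs_ctx s1 s2).
Proof.
  assert (Hctx := dwf_Prod_ctx s1 s2).
  assert (HA : dty DK (Prod_ctx s1 s2) (dVar 1) (dU s1))
    by exact (dty_var DK _ 1 _ Hctx eq_refl).
  assert (HB : dty DK (Prod_ctx s1 s2) (dVar 0)
      (dPi (dEl s1 (dVar 1)) (dU s2)))
    by exact (dty_var DK _ 0 _ Hctx eq_refl).
  apply dwf_cons, dty_pi; [now apply dty_El |].
  exact (dty_El_app_var0 _ _ _ _ _ HA HB).
Qed.

Lemma dty_abs D s1 s2 s3 A B M :
  rul P s1 s2 s3 ->
  dty DK D A (dU s1) -> dty DK D B (dPi (dEl s1 A) (dU s2)) ->
  dty DK D M (dPi (dEl s1 A) (dEl s2 (dApp (dren S B) (dVar 0)))) ->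
  dty DK D (dabs s1 s2 A B M) (dEl s3 (dProd s1 s2 A B)).
Proof.
  intros Hrul HA HB HM. assert (Hctx := dwf_abs_ctx s1 s2).
  refine (dty_cst DK D (cabs s1 s2) [A; B; M]%vector _
    (dEl s3 (dProd s1 s2 (dVar 2) (dVar 1))) TYPE (sig_abs P _ _ _ Hrul) _ _).
  - apply dty_El, dty_Prod; auto.
    + exact (dty_var DK _ 2 _ Hctx eq_refl).
    + exact (dty_var DK _ 1 _ Hctx eq_refl).
  - apply dinst_cons; [exact (dinst_Prod_ctx _ _ _ _ _ HA HB) | exact HM].
Qed.

Lemma dwf_app_ctx s1 s2 s3 : rul P s1 s2 s3 -> dwf DK (app_ctx s1 s2 s3).
Proof.
  intros Hrul. assert (Hctx := dwf_Prod_ctx s1 s2).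
  assert (HM : dwf DK
    (dEl s3 (dProd s1 s2 (dVar 1) (dVar 0)) :: Prod_ctx s1 s2)).
  { apply dwf_cons, dty_El, dty_Prod; auto.
    - exact (dty_var DK _ 1 _ Hctx eq_refl).
    - exact (dty_var DK _ 0 _ Hctx eq_refl). }
  apply dwf_cons, dty_El. exact (dty_var DK _ 2 _ HM eq_refl).
Qed.

Lemma dty_capp D s1 s2 s3 A B M N :
  rul P s1 s2 s3 ->
  dty DK D A (dU s1) -> dty DK D B (dPi (dEl s1 A) (dU s2)) ->
  dty DK D M (dEl s3 (dProd s1 s2 A B)) -> dty DK D N (dEl s1 A) ->
  dty DK D (dapp s1 s2 A B M N) (dEl s2 (dApp B N)).
Proof.
  intros Hrul HA HB HM HN. assert (Hctx := dwf_app_ctx s1 s2 s3 Hrul).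
  refine (dty_cst DK D (capp s1 s2) [A; B; M; N]%vector _
    (dEl s2 (dApp (dVar 2) (dVar 0))) TYPE (sig_app P _ _ _ Hrul) _ _).
  - apply (dty_El_app _ s1 s2 (dVar 3)).
    + exact (dty_var DK _ 2 _ Hctx eq_refl).
    + exact (dty_var DK _ 0 _ Hctx eq_refl).
  - apply dinst_cons; [|exact HN].
    apply dinst_cons; [exact (dinst_Prod_ctx _ _ _ _ _ HA HB) | exact HM].
Qed.

End Encoding.

(** * Soundness of the translation *)

Section Soundness.

Context {P : pts_spec}.
Local Notation DK := (epts_theory P).
Implicit Types (G : ectx P) (D : list (dkterm (sort P))) (s : sort P).
Implicit Types (A B M N : eterm (sort P)) (T : dkterm (sort P)).

Lemma tr_econv M M' : econv P M M' -> dconv DK (tr M) (tr M').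
Proof.
  apply clos_rst_map. clear M M'.
  induction 1 as [s1 s2 s3 A B A' B' M N Hrul | | | | | | | | |]; simpl.
  { eapply rst_trans; apply rst_step.
    - exact (dred_app_abs _ _ _ _ _ _ _ _ _ Hrul).
    - rewrite tr_esubst1. constructor. }
  all: first [apply (dconv_cst DK (cProd _ _)) | apply (dconv_cst DK (cabs _ _))
    | apply (dconv_cst DK (capp _ _))];
    repeat apply Vector.Forall2_cons; try apply Vector.Forall2_nil;
    try apply dconv_lam; try apply dconv_El; assumption || apply rst_refl.
Qed.

Lemma tr_ctx_nth G D n A :
  tr_ctx P G D -> nth_error G n = Some A ->
  exists s, nth_error D n = Some (dEl s (tr A)) /\
    ety P G (eren (shift n) A) (eSort s).
Proof.
  intros HD. revert n A.
  induction HD as [|G D C s HD IH HC]; intros [|n] A Hn; try discriminate;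
    simpl in Hn; assert (HG : ewf P (C :: G)) by now apply ewf_cons with s.
  - injection Hn as <-. exists s. split; auto.
    rewrite (ren_shift_0 esubst_laws). exact (ety_weaken _ _ _ _ HC HG).
  - destruct (IH _ _ Hn) as [s' [Hn' Hs']]. exists s'. split; auto.
    rewrite (ren_shift_S esubst_laws). exact (ety_weaken _ _ _ _ Hs' HG).
Qed.

Lemma tr_ctx_exists G : ewf P G -> exists D, tr_ctx P G D.
Proof.
  induction G as [|A G IH]; intros HG.
  - exists nil. constructor.
  - inversion HG as [|? ? s HA]; subst.
    destruct (IH (ety_ewf _ _ _ HA)) as [D HD].
    eexists. econstructor; eassumption.
Qed.

(* The type [s] with [axm P s s'] is translated both as [U_s] and as
   [El_s' u_s], which are convertible. *)
Inductive tr_type G : eterm (sort P) -> dkterm (sort P) -> Prop :=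
| tr_type_U s : tr_type G (eSort s) (dU s)
| tr_type_El A s : ety P G A (eSort s) -> tr_type G A (dEl s (tr A)).

Definition tr_sound G M A : Prop :=
  forall D T, tr_ctx P G D -> tr_type G A T -> dty DK D (tr M) T.

Lemma tr_sound_U G D M s :
  tr_sound G M (eSort s) -> tr_ctx P G D -> dty DK D (tr M) (dU s).
Proof. intros HM HD. apply HM; [exact HD | constructor]. Qed.

Lemma tr_sound_El G D M A s :
  tr_sound G M A -> tr_ctx P G D -> ety P G A (eSort s) ->
  dty DK D (tr M) (dEl s (tr A)).
Proof. intros HM HD HA. apply HM; [exact HD | now constructor]. Qed.

Lemma dty_tr_family G D s1 s2 A B :
  tr_ctx P G D -> ety P G A (eSort s1) ->
  tr_sound G A (eSort s1) -> tr_sound (A :: G) B (eSort s2) ->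
  dty DK D (dLam (dEl s1 (tr A)) (tr B)) (dPi (dEl s1 (tr A)) (dU s2)).
Proof.
  intros HD HA HA' HB'.
  assert (HtrA := tr_sound_U _ _ _ _ HA' HD).
  assert (HtrB := tr_sound_U _ _ _ _ HB' (tr_cons _ _ _ _ _ HD HA)).
  apply dty_lam with TYPE; auto using dty_El.
  now apply dty_U, dty_dwf with (tr B) (dU s2).
Qed.

Hypothesis HP : functional_pts P.

Lemma tr_ctx_unique G D D' : tr_ctx P G D -> tr_ctx P G D' -> D = D'.
Proof.
  intros HD. revert D'.
  induction HD as [|G D A s HD IH HA]; intros D' HD';
    inversion HD' as [|? D'' ? s' HD'' HA']; subst; auto.
  now rewrite (ety_unique_sort HP _ _ _ _ HA HA'), (IH _ HD'').
Qed.

Lemma dty_tr_type G D M A T T' :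
  tr_type G A T -> tr_type G A T' -> dty DK D (tr M) T -> dty DK D (tr M) T'.
Proof.
  intros HT HT' HM. assert (HD := dty_dwf _ _ _ HM).
  destruct HT as [s | A s HA]; inversion HT' as [s' | A' s' HA']; subst; auto.
  - apply ety_sort_axm in HA'.
    eapply dty_conv; [exact HM | now apply dty_El, dty_u |].
    now apply rst_sym, dconv_El_u.
  - apply ety_sort_axm in HA.
    eapply dty_conv; [exact HM | now apply dty_U | now apply dconv_El_u].
  - now rewrite (ety_unique_sort HP _ _ _ _ HA' HA).
Qed.

Lemma tr_sound_intro G M A T :
  tr_type G A T -> (forall D, tr_ctx P G D -> dty DK D (tr M) T) ->
  tr_sound G M A.
Proof. intros HT HM D T' HD HT'. apply (dty_tr_type G D M A T); auto. Qed.

Lemma tr_sound_conv G M A B s :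
  ety P G M A -> ety P G B (eSort s) -> econv P A B ->
  tr_sound G M A -> tr_sound G B (eSort s) -> tr_sound G M B.
Proof.
  intros HM HB HAB IHM IHB.
  apply (tr_sound_intro _ _ _ _ (tr_type_El _ _ _ HB)). intros D HD.
  apply dty_conv with (dEl s (tr A)) TYPE.
  - apply (tr_sound_El G); auto. exact (ety_econv_sort HP _ _ _ _ _ HM HAB HB).
  - apply dty_El. now apply (tr_sound_U G).
  - now apply dconv_El, tr_econv.
Qed.

Lemma tr_sound_var G n A :
  ewf P G -> nth_error G n = Some A ->
  (forall D, tr_ctx P G D -> dwf DK D) ->
  tr_sound G (eVar n) (eren (shift n) A).
Proof.
  intros HG Hn Hdwf. destruct (ewf_nth _ _ _ HG Hn) as [s Hs].
  apply (tr_sound_intro _ _ _ _ (tr_type_El _ _ _ Hs)). intros D HD.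
  destruct (tr_ctx_nth _ _ _ _ HD Hn) as [s' [Hn' Hs']].
  rewrite (ety_unique_sort HP _ _ _ _ Hs Hs'), tr_eren.
  exact (dty_var DK D n _ (Hdwf D HD) Hn').
Qed.

Lemma tr_sound_pi G s1 s2 s3 A B :
  rul P s1 s2 s3 -> ety P G A (eSort s1) ->
  tr_sound G A (eSort s1) -> tr_sound (A :: G) B (eSort s2) ->
  tr_sound G (ePi s1 s2 A B) (eSort s3).
Proof.
  intros Hrul HA IHA IHB.
  apply (tr_sound_intro _ _ _ _ (tr_type_U _ _)). intros D HD.
  apply dty_Prod; auto.
  - now apply (tr_sound_U G).
  - now apply (dty_tr_family G).
Qed.

Lemma tr_sound_lam G s1 s2 s3 A B M :
  rul P s1 s2 s3 -> ety P G A (eSort s1) -> ety P (A :: G) B (eSort s2) ->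
  tr_sound G A (eSort s1) -> tr_sound (A :: G) B (eSort s2) ->
  tr_sound (A :: G) M B -> tr_sound G (eLam s1 s2 A B M) (ePi s1 s2 A B).
Proof.
  intros Hrul HA HB IHA IHB IHM.
  apply (tr_sound_intro _ _ _ _
    (tr_type_El _ _ _ (ety_pi _ _ _ _ _ _ _ Hrul HA HB))).
  intros D HD. assert (HAD := tr_cons _ _ _ _ _ HD HA).
  assert (HtrA := tr_sound_U _ _ _ _ IHA HD).
  assert (HtrB := dty_tr_family _ _ _ _ _ _ HD HA IHA IHB).
  assert (HEl := dty_El_app_var0 _ _ _ _ _ HtrA HtrB).
  apply dty_abs; auto. apply dty_lam with TYPE; auto using dty_El.
  apply dty_conv with (dEl s2 (tr B)) TYPE; auto.
  - now apply (tr_sound_El (A :: G)).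
  - apply dconv_El, rst_sym, dconv_eta_lam.
Qed.

Lemma tr_sound_app G s1 s2 s3 A B M N :
  rul P s1 s2 s3 -> ety P G A (eSort s1) -> ety P (A :: G) B (eSort s2) ->
  ety P G N A -> tr_sound G A (eSort s1) -> tr_sound (A :: G) B (eSort s2) ->
  tr_sound G N A -> tr_sound G M (ePi s1 s2 A B) ->
  tr_sound G (eApp s1 s2 A B M N) (esubst1 N B).
Proof.
  intros Hrul HA HB HN IHA IHB IHN IHM.
  assert (HBN := ety_esubst1 _ _ _ _ _ HB HN).
  apply (tr_sound_intro _ _ _ _ (tr_type_El _ _ _ HBN)). intros D HD.
  assert (HtrN := tr_sound_El _ _ _ _ _ IHN HD HA).
  assert (HtrB := tr_sound_U _ _ _ _ IHB (tr_cons _ _ _ _ _ HD HA)).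
  rewrite tr_esubst1.
  apply dty_conv with
    (dEl s2 (dApp (dLam (dEl s1 (tr A)) (tr B)) (tr N))) TYPE.
  - apply dty_capp with s3; auto.
    + now apply (tr_sound_U G).
    + now apply (dty_tr_family G).
    + apply (tr_sound_El G D M (ePi s1 s2 A B)); auto. now apply ety_pi.
  - apply dty_El. exact (dty_dsubst1 _ _ _ _ _ HtrB HtrN).
  - apply dconv_El, rst_step. constructor.
Qed.

Scheme ety_ewf_ind := Minimality for ety Sort Prop
  with ewf_ety_ind := Minimality for ewf Sort Prop.

Combined Scheme ety_ewf_mutind from ety_ewf_ind, ewf_ety_ind.

Theorem tr_preserves_typing :
  (forall G M A, ety P G M A -> tr_sound G M A) /\
  (forall G, ewf P G -> forall D, tr_ctx P G D -> dwf DK D).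
Proof.
  apply ety_ewf_mutind.
  - eauto using tr_sound_conv.
  - intros G s1 s2 _ Hdwf Haxm.
    apply (tr_sound_intro _ _ _ _ (tr_type_U _ _)). intros D HD.
    apply dty_u; auto.
  - intros G n A HG Hdwf Hn. now apply tr_sound_var.
  - eauto using tr_sound_pi.
  - eauto using tr_sound_lam.
  - eauto using tr_sound_app.
  - intros D HD. inversion HD. constructor.
  - intros G A s HA IHA D HD. inversion HD as [|? D' ? s' HD' HA']; subst.
    apply dwf_cons, dty_El.
    rewrite (ety_unique_sort HP _ _ _ _ HA' HA). now apply (tr_sound_U G).
Qed.

Lemma tr_ctx_exists_unique G : ewf P G -> exists D, unique (tr_ctx P G) D.
Proof.
  intros HG. destruct (tr_ctx_exists _ HG) as [D HD].
  exists D. split; auto. intros D'. now apply tr_ctx_unique.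
Qed.

Lemma ety_type_sort_unique G M A :
  ety P G M A -> ~ (exists s, A = eSort s /\ top_sort P s) ->
  exists sA, unique (fun s => ety P G A (eSort s)) sA.
Proof.
  intros HM Htop.
  assert (Hs : exists s, ety P G A (eSort s)).
  { destruct (ety_type_correct _ _ _ HM) as [[s ->] | HA]; auto.
    destruct (classic (exists s', axm P s s')) as [[s' Haxm] | Hs].
    - exists s'. constructor; auto. exact (ety_ewf _ _ _ HM).
    - exfalso. apply Htop. now exists s. }
  destruct Hs as [s Hs]. exists s. split; auto.
  intros s'. now apply (ety_unique_sort HP G A).
Qed.

End Soundness.

Theorem mainTheorem2 (P : pts_spec) (HP : functional_pts P)
    (G : ectx P) (M A : eterm (sort P)) :
  (ewf P G ->
     exists D, unique (tr_ctx P G) D /\ dwf (epts_theory P) D)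
  /\
  (ety P G M A ->
     exists D, unique (tr_ctx P G) D /\
       (forall s, A = eSort s -> top_sort P s ->
          dty (epts_theory P) D (tr M) (dU s)) /\
       (~ (exists s, A = eSort s /\ top_sort P s) ->
          exists sA, unique (fun s => ety P G A (eSort s)) sA /\
            dty (epts_theory P) D (tr M) (dEl sA (tr A)))).
Proof.
  destruct (tr_preserves_typing HP) as [Hsound Hdwf]. split.
  - intros HG. destruct (tr_ctx_exists_unique HP _ HG) as [D HD].
    exists D. split; auto. exact (Hdwf G HG D (proj1 HD)).
  - intros HM. apply Hsound in HM as HtrM.
    destruct (tr_ctx_exists_unique HP _ (ety_ewf _ _ _ HM)) as [D HD].
    exists D. split; [exact HD | split].
    + intros s -> _. exact (tr_sound_U _ _ _ _ HtrM (proj1 HD)).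
    + intros Htop. destruct (ety_type_sort_unique HP _ _ _ HM Htop) as [s Hs].
      exists s. split; [exact Hs |].
      exact (tr_sound_El _ _ _ _ _ HtrM (proj1 HD) (proj1 Hs)).
Qed.
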